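(* Let $\Bbbk$ be a field, $B$ a finite set, $\deg\colon B\to\mathbb Z^m$ a function, and $P$ a poset structure on $B$ such that $\deg\colon P\to\mathbb Z^m$ is a morphism of posets, such that $\dim_\Bbbk\widetilde H_{d_P(a)-1}(\Delta(P_{<a});\Bbbk)=1$ for each $a\in B$, and such that $\widetilde{\mathcal C}_\bullet(P_{\deg\le\alpha},\Bbbk)$ is exact for every $\alpha\in\mathbb Z^m$ with $P_{\deg\le\alpha}$ nonempty. Then there exists an hcw-poset structure $Q$ over $\Bbbk$ on the set $B$ such that: (1) $\mathrm{id}_B\colon P\to Q$ and $\deg\colon Q\to\mathbb Z^m$ are morphisms of posets; (2) $\dim\Delta(P_{\le a})=\dim\Delta(Q_{\le a})$ for every $a\in B$; (3) $\widetilde{\mathcal C}_\bullet(P,\Bbbk)=\widetilde{\mathcal C}_\bullet(Q,\Bbbk)$ as subcomplexes of the augmented simplicial chain complex of $\Delta(Q)$.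
   Context: For a finite poset $P$ and $a\in P$: $P_{\le a},P_{<a}$ the sets of elements $\le a$, resp. $<a$; $\Delta(S)$ the order complex; $d_P(a)=\dim\Delta(P_{\le a})$; faces oriented by listing vertices in decreasing order. A finite poset $Q$ is a homology CW-poset (hcw-poset) over $\Bbbk$ if for every $a\in Q$, $\widetilde H_i(\Delta(Q_{<a});\Bbbk)\cong\Bbbk$ for $i=\dim\Delta(Q_{<a})$ and $=0$ for all other $i$ (the empty complex has dimension $-1$ and $\widetilde H_{-1}=\Bbbk$). Conic chain complex: $\mathcal C_n(P,\Bbbk)=H_n(\Delta^n,\Delta^{n-1};\Bbbk)$ where $\Delta^n=\Delta(\{a:d(a)\le n\})$, identified with the subspace of simplicial $n$-chains of $\Delta(P)$ spanned by chains $[c,z]$ with $d(c)=n$ and $z$ an $(n-1)$-cycle of $\Delta(P_{<c})$ ($[c,\cdot]$ prepends vertex $c$ linearly), with simplicial boundary as differential; the augmented version $\widetilde{\mathcal C}_\bullet(P,\Bbbk)$ adds $\mathcal C_{-1}=\Bbbk\cdot[\,]$ with $\partial_0[c]=[\,]$. $P_{\deg\le\alpha}=\{x:\deg x\le\alpha\}$ with the induced order. *)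

(* Defs.v *)
From HB Require Import structures.
From mathcomp Require Import all_boot all_order all_algebra.
Set Implicit Arguments. Unset Strict Implicit. Unset Printing Implicit Defensive.
Import Order.TTheory GRing.Theory Num.Theory.

(* Conventions:
   - a poset structure on a finite set B is a relation [le : rel B] which is
     reflexive, antisymmetric and transitive;
   - a (sub)poset is given by [le] together with a subset [S : {set B}]
     carrying the induced order;
   - a face of the order complex Delta(S) is a chain c of S, i.e. a subset of S
     that is totally ordered; the empty chain is the empty face (augmentation);
     a face c has dimension #|c| - 1;
   - chains with coefficients in a field K are row vectors indexed by
     {set B} (via enum_rank / enum_val); every simplex is oriented by listing
     its vertices in decreasing order, so that the coefficient of
     [c \ v] in the boundary of [c] is (-1)^(number of w in c with v < w). *)

Local Open Scope ring_scope.
Section Complexes.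
Variables (K : fieldType) (B : finType).

Definition nS := #|{: {set B}}|.

Definition is_porder (le : rel B) : Prop :=
  [/\ reflexive le, antisymmetric le & transitive le].

Definition ltr (le : rel B) (x y : B) : bool := (x != y) && le x y.

Definition below (le : rel B) (a : B) : {set B} := [set x | ltr le x a].
Definition atmost (le : rel B) (a : B) : {set B} := [set x | le x a].

Definition is_chain (le : rel B) (c : {set B}) : bool :=
  [forall x in c, forall y in c, le x y || le y x].

Definition face (le : rel B) (S c : {set B}) : bool :=
  (c \subset S) && is_chain le c.

(* dimension of Delta(S); it is -1 for S empty *)
Definition cdim (le : rel B) (S : {set B}) : int :=
  (\max_(c : {set B} | face le S c) #|c|)%N%:Z - 1.

Definition dP (le : rel B) (S : {set B}) (a : B) : int :=
  cdim le (S :&: atmost le a).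

Definition bd (le : rel B) : 'M[K]_nS :=
  \matrix_(i, j)
    (let c := enum_val i in let s := enum_val j in
     if is_chain le c then
       \sum_(v in c | s == c :\ v) (-1) ^+ #|[set w in c | ltr le v w]|
     else 0).

Definition faces_mx (le : rel B) (S : {set B}) (n : int) : 'M[K]_nS :=
  diag_mx (\row_j (face le S (enum_val j) && (#|enum_val j|%:Z == n + 1))%:R).

Definition hdim (le : rel B) (S : {set B}) (n : int) : nat :=
  (\rank (faces_mx le S n :&: kermx (bd le))%MS
   - \rank (faces_mx le S (n + 1) *m bd le)%MS)%N.

Definition cone_mx (c : B) : 'M[K]_nS :=
  \matrix_(i, j) ((c \notin (enum_val i : {set B})) && ((enum_val j : {set B}) == c |: enum_val i))%:R.

Definition cycles_mx (le : rel B) (S : {set B}) (n : int) : 'M[K]_nS :=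
  (faces_mx le S n :&: kermx (bd le))%MS.

(* the augmented conic chain complex, degree n (a subspace of chains of
   Delta(S), given as the row space of a matrix) *)
Definition conic (le : rel B) (S : {set B}) (n : int) : 'M[K]_nS :=
  if n == -1 then faces_mx le S (-1)
  else (\sum_(c in S | dP le S c == n)
          (cycles_mx le (S :&: below le c) (n - 1) *m cone_mx c))%MS.

Definition conic_exact (le : rel B) (S : {set B}) : Prop :=
  forall n : int,
    (conic le S n :&: kermx (bd le) == conic le S (n + 1) *m bd le)%MS.

Definition hcw_poset (le : rel B) : Prop :=
  is_porder le /\
  forall (a : B) (n : int),
    hdim le (below le a) n = (if n == cdim le (below le a) then 1 else 0)%N.

End Complexes.

Arguments is_porder {B} le.
Arguments below {B} le a.
Arguments atmost {B} le a.
Arguments cdim {B} le S.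
Arguments dP {B} le S a.

Definition leZm (m : nat) (x y : 'I_m -> int) : bool := [forall i, x i <= y i]%R.

Definition deg_le_set (B : finType) (m : nat) (deg : B -> 'I_m -> int)
  (alpha : 'I_m -> int) : {set B} := [set x | leZm (deg x) alpha].

(* Main.v *)
(** Write [h x] for [d(x) + 1], the largest cardinality of a chain with top
    element [x]. The cycle space in question on [P_{<a}] is a line, spanned by
    some [g a], and the cells [[a, g a]] form a basis of the conic complex with
    [bd [a, g a] = g a]. For each [c] extend the set of all [x <_P c] with
    [h x = h c - 1] to a set [X c] of elements [x] with [h x = h c - 1] and
    [deg x <= deg c], minimal such that the [g x] with [x] in [X c] span all
    boundaries available in degrees [<= deg c]. By minimality every relation
    among these [g x] comes from [P_{<c}], hence is a multiple of [g c]. In [Q]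
    the elements below [c] are those of [X c] and all [x] with [deg x <= deg c]
    and [h x <= h c - 2]. By induction on [h c], a simplicial cycle of [Q_{<c}]
    is homologous to a conic one, so the homology of [Q_{<c}] is read off the
    conic complex: exactness kills it below the top degree, and in the top
    degree the cycles are the multiples of [g c]. *)
Require Import Defs.
From HB Require Import structures.
From mathcomp Require Import all_boot all_order all_algebra zify.

Set Implicit Arguments.
Unset Strict Implicit.
Unset Printing Implicit Defensive.
Import Order.TTheory GRing.Theory Num.Theory.
Local Open Scope ring_scope.

Reserved Notation "v $ s" (at level 8, s at level 2, format "v $ s").

(** * Chains as coefficient functions on faces: boundary, cone and link *)

Section Coordinates.
Variables (K : fieldType) (B : finType).
Implicit Types (v z : 'rV[K]_(nS B)) (s t S T : {set B}) (le : rel B).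

Definition coef v s : K := v 0 (enum_rank s).
Local Notation "v $ s" := (coef v s).

(** The index [k] counts vertices, so it is the dimension plus one: the augmentation degree is
    [k = 0] and no negative index occurs. *)
Definition chain_on le S k v : Prop :=
  forall s, v$s != 0 -> face le S s /\ #|s| = k.

Definition cycle_on le S k v : Prop := chain_on le S k v /\ v *m bd K le = 0.

Lemma coef_inj v z : (forall s, v$s = z$s) -> v = z.
Proof.
by move=> E; apply/rowP=> j; have := E (enum_val j); rewrite /coef enum_valK.
Qed.

Lemma coef_addv v z s : (v + z)$s = v$s + z$s. Proof. by rewrite /coef mxE. Qed.
Lemma coef_subv v z s : (v - z)$s = v$s - z$s. Proof. by rewrite /coef !mxE. Qed.
Lemma coef_scalev a v s : (a *: v)$s = a * v$s. Proof. by rewrite /coef mxE. Qed.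
Lemma coef_zerov s : 0$s = 0. Proof. by rewrite /coef mxE. Qed.

Lemma coef_mulmx v (M : 'M[K]_(nS B)) s :
  (v *m M)$s = \sum_t v$t * M (enum_rank t) (enum_rank s).
Proof.
rewrite /coef mxE (reindex_onto enum_rank enum_val) //= => [|i _].
  by under eq_bigl do rewrite enum_rankK eqxx.
by rewrite enum_valK.
Qed.

(** The matrix [bd] lists the facets of each simplex; transposing the sum lists instead the vertices
    that can be added to [s]. *)
Lemma coef_bd le v s :
  (v *m bd K le)$s =
  \sum_(w | (w \notin s) && is_chain le (w |: s))
    v$(w |: s) * (-1) ^+ #|[set u in w |: s | ltr le w u]|.
Proof.
rewrite coef_mulmx.
have E t w : (w \in t) && (s == t :\ w) = (w \notin s) && (t == w |: s).
  apply/andP/andP=> [[wt /eqP->]|[ws /eqP->]].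
    by rewrite setD11 setD1K // eqxx.
  by rewrite setU11 setU1K // eqxx.
transitivity (\sum_t \sum_(w | (w \notin s) && (t == w |: s))
  if is_chain le (w |: s) then
    v$(w |: s) * (-1) ^+ #|[set u in w |: s | ltr le w u]| else 0).
  apply: eq_bigr => t _; rewrite mxE /= !enum_rankK.
  case: (boolP (is_chain le t)) => ct; last first.
    rewrite mulr0 big1 // => w /andP[_ /eqP Et].
    by rewrite -Et (negPf ct).
  rewrite mulr_sumr (eq_bigl _ _ (E t)); apply: eq_bigr => w /andP[_ /eqP Et].
  by rewrite -Et ct.
rewrite (exchange_big_dep (fun w => w \notin s)) /=; last by move=> t w _ /andP[].
rewrite big_mkcondr /=; apply: eq_bigr => w ws.
by rewrite (big_pred1 (w |: s)) // => t; rewrite ws.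
Qed.

Lemma coef_cone x v t : (v *m cone_mx K x)$t = if x \in t then v$(t :\ x) else 0.
Proof.
rewrite coef_mulmx; under eq_bigr => s _ do rewrite mxE !enum_rankK.
case: ifP => xt; last first.
  rewrite big1 // => s _; case: eqP => [Et|]; last by rewrite andbF mulr0.
  by move: xt; rewrite Et setU11.
rewrite (bigD1 (t :\ x)) //= setD11 setD1K // eqxx mulr1 big1 ?addr0 //.
move=> s /eqP ns; case: (boolP (x \in s)) => xs /=; rewrite ?mulr0 //.
by case: eqP => Et; rewrite ?mulr0 //; case: ns; rewrite Et setU1K.
Qed.

(** No sign appears because the link is applied where [x] is the greatest vertex, hence listed
    first. Coning it with [x] returns the part of [v] on faces containing [x]. *)
Definition link x v : 'rV[K]_(nS B) :=
  \row_j if x \in (enum_val j : {set B}) then 0 else v$(x |: enum_val j).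

Lemma coef_link x v s : (link x v)$s = if x \in s then 0 else v$(x |: s).
Proof. by rewrite /coef mxE enum_rankK. Qed.

Lemma faces_mxP le S n v :
  reflect (forall s, v$s != 0 -> face le S s /\ #|s|%:Z = n + 1)
          (v <= faces_mx K le S n)%MS.
Proof.
apply: (iffP idP) => [/submxP[D ->] s|Hv].
  rewrite /coef /faces_mx mul_mx_diag !mxE enum_rankK.
  by case: face; case: (#|s|%:Z =P n + 1) => /= E; rewrite ?mulr0 ?eqxx.
suff -> : v = v *m faces_mx K le S n by apply: submxMl.
apply: coef_inj => s; rewrite /coef /faces_mx mul_mx_diag !mxE enum_rankK.
have [/eqP E|/Hv[-> ->]] := boolP (v$s == 0); last by rewrite eqxx mulr1.
by rewrite -/(coef v s) E mul0r.
Qed.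

Lemma cycles_mxP le S (k : nat) v :
  reflect (cycle_on le S k v) (v <= cycles_mx K le S (k%:Z - 1))%MS.
Proof.
rewrite sub_capmx; apply: (iffP andP) => -[].
  move=> /faces_mxP Hv /sub_kermxP bv; split=> // s /Hv[-> E]; split=> //.
  by move: E; rewrite subrK => -[].
move=> Hv bv; split; last by apply/sub_kermxP.
by apply/faces_mxP => s /Hv[-> ->]; rewrite subrK.
Qed.

Lemma chain_onW le S T k v : S \subset T -> chain_on le S k v -> chain_on le T k v.
Proof. by move=> sST Hv s /Hv[/andP[sS cs] ->]; rewrite /face (subset_trans sS). Qed.

Lemma chain_on0 le S k : chain_on le S k 0.
Proof. by move=> s; rewrite coef_zerov eqxx. Qed.

Lemma chain_onD le S k v z :
  chain_on le S k v -> chain_on le S k z -> chain_on le S k (v + z).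
Proof.
move=> Hv Hz s; rewrite coef_addv; have [/eqP->|/Hv //] := boolP (v$s == 0).
by rewrite add0r => /Hz.
Qed.

Lemma chain_onZ le S k a v : chain_on le S k v -> chain_on le S k (a *: v).
Proof. by move=> Hv s; rewrite coef_scalev mulf_eq0 negb_or => /andP[_ /Hv]. Qed.

Lemma chain_on_sum le S k (I : finType) (X : pred I) (f : I -> 'rV[K]_(nS B)) :
  (forall i, X i -> chain_on le S k (f i)) -> chain_on le S k (\sum_(i | X i) f i).
Proof.
move=> Hf; elim/big_ind: _ => //; first exact: chain_on0.
exact: chain_onD.
Qed.

Lemma is_chainP le s :
  reflect {in s &, forall x y, le x y || le y x} (is_chain le s).
Proof.
apply: (iffP forall_inP) => [H x y xs ys|H x xs].
  by move/forall_inP: (H _ xs) => /(_ _ ys).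
by apply/forall_inP => y ys; apply: H.
Qed.

Lemma is_chainS le s t : s \subset t -> is_chain le t -> is_chain le s.
Proof.
move=> /subsetP sst /is_chainP ct; apply/is_chainP=> x y /sst xt /sst yt.
exact: ct.
Qed.

Section Poset.
Variables (le : rel B) (lePO : is_porder le).

Lemma is_chainU1 x s : reflexive le -> s \subset below le x -> is_chain le s ->
  is_chain le (x |: s).
Proof.
move=> rle /subsetP sx /is_chainP cs; apply/is_chainP => u w.
have lx y : y \in s -> le y x by move=> /sx; rewrite inE => /andP[].
case/setU1P=> [->|us]; case/setU1P=> [->|ws]; rewrite ?rle ?lx ?orbT //.
exact: cs.
Qed.

Lemma strict_asym x y : ltr le x y -> ltr le y x = false.
Proof.
case: lePO => _ ale _ /andP[/eqP nxy lxy]; apply/negP=> /andP[_ lyx].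
by apply: nxy; apply: ale; rewrite lxy.
Qed.

Lemma strict_trans x y w : ltr le x y -> ltr le y w -> ltr le x w.
Proof.
case: lePO => _ ale tle Hxy Hyz; apply/andP; split.
  by apply: contraTneq Hxy => ->; rewrite strict_asym.
by move: Hxy Hyz => /andP[_ /tle H] /andP[_]; apply: H.
Qed.

Lemma below_irr x : x \notin below le x.
Proof. by rewrite inE /ltr eqxx. Qed.

(* The orientation lists the cone point [x] first, so coning moves every other
   vertex by one position. *)
Lemma card_above_U1 x w s : w \notin s -> w |: s \subset below le x ->
  #|[set u in w |: (x |: s) | ltr le w u]| = #|[set u in w |: s | ltr le w u]|.+1.
Proof.
move=> ws /subsetP sx.
have -> : [set u in w |: (x |: s) | ltr le w u]
        = x |: [set u in w |: s | ltr le w u].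
  apply/setP=> u; rewrite !inE; case: (u =P x) => [->|] //=; rewrite orbT /=.
  by have := sx w (setU11 _ _); rewrite inE.
rewrite cardsU1 inE negb_and; case: (boolP (x \in _)) => // /sx.
by rewrite (negPf (below_irr x)).
Qed.

(** Deleting the apex, listed first, returns [v] with sign [+1]; deleting any other vertex commutes
    with coning up to the sign [-1]. *)
Lemma bd_cone x k v : chain_on le (below le x) k v ->
  v *m cone_mx K x *m bd K le = v - (v *m bd K le) *m cone_mx K x.
Proof.
have [rle _ _] := lePO.
move=> Hv; apply: coef_inj => s; rewrite coef_subv coef_cone coef_bd.
have [xs|xs] := boolP (x \in s); last first.
  rewrite subr0.
  have [/eqP v0|/Hv[/andP[sx cs] _]] := boolP (v$s == 0).
    rewrite v0 big1 // => w /andP[ws _]; rewrite coef_cone.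
    case: ifP; last by rewrite mul0r.
    by case/setU1P=> [->|]; [rewrite setU1K // v0 mul0r|rewrite (negPf xs)].
  rewrite (bigD1 x) /=; last by rewrite xs is_chainU1.
  rewrite coef_cone setU11 setU1K //.
  have -> : [set u in x |: s | ltr le x u] = set0.
    apply/setP=> u; rewrite !inE; apply/negP=> /andP[/orP[/eqP->|us]].
      by rewrite /ltr eqxx.
    by have := subsetP sx _ us; rewrite inE => /strict_asym->.
  rewrite cards0 mulr1 big1 ?addr0 // => w /andP[_ /negPf wx].
  rewrite coef_cone in_setU1 eq_sym wx (negPf xs) /= mul0r //.
have -> : v$s = 0.
  apply/eqP/negPn/negP=> /Hv[/andP[/subsetP/(_ _ xs)]].
  by rewrite (negPf (below_irr x)).
rewrite sub0r coef_bd -sumrN big_mkcond [RHS]big_mkcond /=; apply: eq_bigr => w _.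
rewrite coef_cone in_setU1 xs orbT.
have [->|nwx] := eqVneq w x.
  rewrite xs !inE eqxx /= setD1K //.
  case: ifP => // _; have [/eqP->|/Hv[/andP[/subsetP/(_ _ xs)]]] := boolP (v$s == 0).
    by rewrite mul0r oppr0.
  by rewrite (negPf (below_irr x)).
have E : (w |: s) :\ x = w |: s :\ x.
  apply/setP=> u; rewrite !inE; case: (u =P w) => [->|] //=.
  by rewrite nwx.
rewrite E !inE nwx /=.
have [/eqP->|/Hv[/andP[sx cs] _]] := boolP (v$(w |: s :\ x) == 0).
  by rewrite !mul0r oppr0; do 2 case: ifP.
have {1}-> : w |: s = x |: (w |: s :\ x) by rewrite setUCA setD1K.
rewrite cs is_chainU1 //; case: ifP => //; rewrite !andbT => ws.
have ws' : w \notin s :\ x by rewrite !inE negb_and ws orbT.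
by rewrite -{2}(setD1K xs) (card_above_U1 ws' sx) exprS mulN1r mulrN.
Qed.

Lemma chain_on_cone x S k v : x \in S -> below le x \subset S ->
  chain_on le (below le x) k v -> chain_on le S k.+1 (v *m cone_mx K x).
Proof.
have [rle _ _] := lePO.
move=> xS bS Hv s; rewrite coef_cone; case: ifP => [xs|]; last by rewrite eqxx.
move/Hv=> [/andP[sx cs] <-]; rewrite [#|s|](cardsD1 x) xs; split=> //.
rewrite -(setD1K xs) /face is_chainU1 // andbT subUset sub1set xS.
exact: subset_trans bS.
Qed.

(** At a face [x |: s] the boundary of [z] sees only simplices containing [x], where [x] is listed
    first; so the boundary of the link at [s] is minus the boundary of [z] at [x |: s]. *)
Lemma cycle_on_link x S k z :
  (forall s, z$s != 0 -> x \in s -> s :\ x \subset below le x) ->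
  cycle_on le S k.+1 z -> cycle_on le (below le x) k (link x z).
Proof.
have [rle _ _] := lePO.
move=> xtop [Hz bz]; split.
  move=> s; rewrite coef_link; case: ifPn => xs; first by rewrite eqxx.
  move=> nz; have := xtop _ nz (setU11 _ _); rewrite setU1K // => sx.
  have [/andP[sS cs]] := Hz _ nz; rewrite cardsU1 xs => -[<-]; split=> //.
  by rewrite /face sx (is_chainS _ cs) // subsetUr.
apply: coef_inj => s; rewrite coef_zerov coef_bd.
have [xs|xs] := boolP (x \in s).
  by rewrite big1 // => w _; rewrite coef_link in_setU1 xs orbT mul0r.
apply/eqP; rewrite -oppr_eq0 -sumrN; apply/eqP.
transitivity ((z *m bd K le)$(x |: s)); last by rewrite bz coef_zerov.
rewrite coef_bd big_mkcond [RHS]big_mkcond /=; apply: eq_bigr => w _.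
rewrite coef_link !in_setU1 (negPf xs) orbF eq_sym.
have [->|nwx] /= := eqVneq w x; first by rewrite mul0r oppr0; case: ifP.
rewrite setUCA.
have [/eqP->|nz] := boolP (z$(w |: (x |: s)) == 0).
  by rewrite !mul0r oppr0; do 2 case: ifP.
have := xtop _ nz; rewrite !inE eqxx orbT => /(_ isT).
have -> : (w |: (x |: s)) :\ x = w |: s.
  by rewrite setUCA setU1K // !inE negb_or eq_sym nwx.
move=> sx; have [/andP[_ cs] _] := Hz _ nz.
rewrite cs (is_chainS _ cs); last by rewrite setUCA subsetUr.
rewrite !andbT; case: ifP => // ws.
by rewrite (card_above_U1 ws sx) exprS mulN1r mulrN.
Qed.

End Poset.
End Coordinates.

(** * Minimal spanning families of vectors *)

Section Span.
Variables (K : fieldType) (B : finType) (n : nat).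
Implicit Types (X Y : {set B}) (f : B -> 'rV[K]_n).

Definition row_span X f : 'M[K]_n := (\sum_(x in X) <<f x>>)%MS.

Lemma row_spanP X f (v : 'rV[K]_n) :
  reflect (exists mu : B -> K, v = \sum_(x in X) mu x *: f x) (v <= row_span X f)%MS.
Proof.
apply: (iffP idP) => [/sub_sumsmxP[u ->]|[mu ->]]; last first.
  by apply: summx_sub_sums => x _; rewrite genmxE scalemx_sub.
have /fin_all_exists[mu Emu] : forall x, exists a, u x *m <<f x>>%MS = a *: f x.
  by move=> x; apply/sub_rVP; rewrite (submx_trans (submxMl _ _)) ?genmxE.
by exists mu; apply: eq_bigr => x _.
Qed.

Lemma row_span_subset X Y f : X \subset Y -> (row_span X f <= row_span Y f)%MS.
Proof.
move=> /subsetP sXY; apply/sumsmx_subP=> x /sXY xY.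
exact: (sumsmx_sup x).
Qed.

(* A minimal spanning set containing [X0]: the new vectors are independent
   modulo the old ones, so every relation lives on [X0]. *)
Lemma row_span_extension X0 Y f : X0 \subset Y ->
  exists X : {set B}, [/\ X0 \subset X, X \subset Y, (row_span Y f <= row_span X f)%MS
    & forall mu : B -> K, \sum_(x in X) mu x *: f x = 0 ->
        forall x, x \in X -> x \notin X0 -> mu x = 0].
Proof.
move=> sX0Y.
pose p X := [&& X0 \subset X, X \subset Y & (row_span Y f <= row_span X f)%MS].
have pY : p Y by rewrite /p sX0Y subxx submx_refl.
have [X /minsetP[/and3P[sX0 sXY spX] minX] _] := minset_exists pY.
exists X; split=> // mu Emu x xX xX0; apply/eqP/negPn/negP=> mux.
(* If [mu x] is nonzero, the relation expresses [f x] through the other vectors, so [X :\ x] is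
   still admissible, against minimality. *)
have /minX/(_ (subsetDl _ _)) E : p (X :\ x).
  apply/and3P; split.
  - apply/subsetP=> y yX0; rewrite !inE (subsetP sX0) // andbT.
    by apply: contraNneq xX0 => <-.
  - by rewrite (subset_trans _ sXY) // subsetDl.
  apply: submx_trans spX _; apply/sumsmx_subP=> y yX; rewrite genmxE.
  have [->|nyx] := eqVneq y x; last first.
    by apply: (sumsmx_sup y); rewrite ?genmxE // !inE nyx.
  move: Emu; rewrite (bigD1 x) //= => /eqP; rewrite addr_eq0 => /eqP Ex.
  have {Ex} -> : f x = \sum_(i in X :\ x) (- (mu x)^-1 * mu i) *: f i.
    transitivity ((mu x)^-1 *: (mu x *: f x)); first by rewrite scalerA mulVf // scale1r.
    rewrite Ex scalerN -scaleNr scaler_sumr.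
    apply: eq_big => [i|i _]; last by rewrite scalerA.
    by rewrite !inE andbC.
  by apply/row_spanP; eexists.
by move: (xX); rewrite -E setD11.
Qed.

End Span.

Local Notation "v $ s" := (coef v s).

(** * Cycles in a poset with a positive, strictly monotone grade, and their reduction to conic
    form *)

Section Graded.
Variables (K : fieldType) (B : finType) (le : rel B) (h : B -> nat).
Hypotheses (lePO : is_porder le) (h_gt0 : forall x, (0 < h x)%N).
Hypothesis h_mono : forall x y, ltr le x y -> (h x < h y)%N.
Implicit Types (v z : 'rV[K]_(nS B)) (s t S T : {set B}).

Lemma chain_lt s x y : is_chain le s -> x \in s -> y \in s -> y != x ->
  (h y <= h x)%N -> ltr le y x.
Proof.
move=> /is_chainP cs xs ys nyx hyx; rewrite /ltr nyx.
case/orP: (cs x y xs ys) => // lxy.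
have := @h_mono x y; rewrite /ltr eq_sym nyx lxy => /(_ isT).
by rewrite ltnNge hyx.
Qed.

Lemma h_inj_chain s : is_chain le s -> {in s &, injective h}.
Proof.
move=> cs x y xs ys Eh; apply/eqP/negPn/negP=> nxy.
have := h_mono (chain_lt cs ys xs nxy (eq_leq Eh)).
by rewrite Eh ltnn.
Qed.

Lemma card_chain_le s k : is_chain le s ->
  (forall x, x \in s -> (h x <= k)%N) -> (#|s| <= k)%N.
Proof.
move=> cs hk; rewrite cardE -(size_map h) -(size_iota 1 k); apply: uniq_leq_size.
  rewrite map_inj_in_uniq ?enum_uniq // => x y; rewrite !mem_enum.
  exact: h_inj_chain.
move=> i /mapP[x]; rewrite mem_enum => xs ->.
by rewrite mem_iota h_gt0 /= add1n ltnS hk.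
Qed.

Lemma chain_top s k : is_chain le s -> (forall x, x \in s -> (h x <= k.+1)%N) ->
  #|s| = k.+1 -> exists2 x, x \in s & h x = k.+1.
Proof.
move=> cs hk Es.
have [/exists_inP[x xs /eqP hx]|/exists_inPn nh] := boolP [exists x in s, h x == k.+1].
  by exists x.
suff: (#|s| <= k)%N by rewrite Es ltnn.
apply: card_chain_le => // x xs.
by rewrite -ltnS ltn_neqAle nh // hk.
Qed.

Lemma top_vertex S k z x s : chain_on le S k z ->
  (forall y, y \in S -> (h y <= h x)%N) ->
  z$s != 0 -> x \in s -> s :\ x \subset below le x.
Proof.
move=> Hz hS /Hz[/andP[sS cs] _] xs; apply/subsetP=> y; rewrite !inE => /andP[nyx ys].
by apply: chain_lt cs xs ys nyx (hS _ (subsetP sS _ ys)).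
Qed.

(** A face with [k.+1] vertices in grades [1..k.+1] has exactly one vertex of grade [k.+1]. Hence
    [z] is the sum of the cones over its links at these vertices, and each link is a cycle. *)
Lemma top_cycle_conic S k z (g : B -> 'rV[K]_(nS B)) :
  (forall x, x \in S -> (h x <= k.+1)%N) ->
  (forall x, x \in S -> h x = k.+1 ->
     forall v, cycle_on le (below le x) k v -> (v <= g x)%MS) ->
  cycle_on le S k.+1 z ->
  (z <= row_span [set x in S | h x == k.+1] (fun x => g x *m cone_mx K x))%MS.
Proof.
move=> hS gS cz; have [Hz _] := cz.
have -> : z = \sum_(x in [set x in S | h x == k.+1]) link x z *m cone_mx K x.
  apply: coef_inj => s; rewrite /coef summxE.
  under eq_bigr => x _ do rewrite -/(coef _ _) coef_cone coef_link setD11.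
  have E x : x \in s -> x |: s :\ x = s by apply: setD1K.
  have [/eqP z0|nz] := boolP (z$s == 0).
    rewrite big1; first by rewrite -/(coef z s).
    by move=> x _; case: ifP => // /E->.
  have [/andP[sS cs] ks] := Hz _ nz.
  have [|x xs hx] := chain_top cs _ ks; first by move=> y /(subsetP sS); apply: hS.
  rewrite (bigD1 x) /= ?xs ?E ?inE ?hx ?eqxx ?(subsetP sS) // big1 ?addr0 //.
  move=> y /andP[]; rewrite !inE => /andP[yS /eqP hy] /eqP nyx.
  case: ifP => // ys; case: nyx; apply: (h_inj_chain cs) => //; by rewrite hx hy.
apply: summx_sub_sums => x; rewrite inE => /andP[xS /eqP hx]; rewrite genmxE submxMr //.
apply: gS => //; apply: (cycle_on_link lePO _ cz) => s.
by apply: (top_vertex Hz) => y /hS; rewrite hx.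
Qed.

(* The vertices of largest grade above the expected one are removed one by one:
   the link of such a vertex is a cycle of a non-critical degree, hence bounds,
   and coning the bounding chain pushes the cycle off the vertex. *)
Lemma push_down S k z (g : B -> 'rV[K]_(nS B)) :
  (forall x y, x \in S -> ltr le y x -> y \in S) ->
  (forall x, x \in S -> h x = k.+1 ->
     forall v, cycle_on le (below le x) k v -> (v <= g x)%MS) ->
  (forall x, x \in S -> h x != k.+1 -> forall v, cycle_on le (below le x) k v ->
     exists2 u, chain_on le (below le x) k.+1 u & u *m bd K le = v) ->
  cycle_on le S k.+1 z ->
  exists u y, [/\ chain_on le S k.+2 u, cycle_on le S k.+1 y,
    (y <= row_span [set x in S | h x == k.+1] (fun x => g x *m cone_mx K x))%MS
    & z = y + u *m bd K le].
Proof.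
move: {2}(#|S|) (leqnn #|S|) => N.
elim: N S z => [|N IH] S z leN dS gS bS cz.
  have S0 : S = set0 by apply: cards0_eq; apply/eqP; rewrite -leqn0.
  exists 0, z; split=> //; [exact: chain_on0| |by rewrite mul0mx addr0].
  by apply: top_cycle_conic cz => // x; rewrite S0 inE.
have [hS|/forall_inPn[x0 x0S hx0]] := boolP [forall x in S, h x <= k.+1]%N.
  exists 0, z; split=> //; [exact: chain_on0| |by rewrite mul0mx addr0].
  by apply: top_cycle_conic cz => // x xS; apply: (forall_inP hS).
have [x xS xmax] := arg_maxnP h x0S; change (is_true (x \in S)) in xS.
have hx : (k.+1 < h x)%N by apply: leq_trans (xmax _ x0S); rewrite ltnNge.
have cl : cycle_on le (below le x) k (link x z).
  apply: (cycle_on_link lePO _ cz) => s; apply: top_vertex; [exact: cz.1|exact: xmax].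
have [u Hu bu] := bS x xS (negbT (gtn_eqF hx)) _ cl.
have bxS : below le x \subset S :\ x.
  apply/subsetP=> y yx; rewrite !inE (dS _ _ xS) ?andbT; last by rewrite inE in yx.
  by apply: contraTneq yx => ->; apply: below_irr.
have sSx : S :\ x \subset S by apply: subsetDl.
(* This is [z] plus the boundary of the cone over [u]; its coefficients on faces containing [x]
   cancel. *)
pose z' := z - link x z *m cone_mx K x + u.
have bcu : u *m cone_mx K x *m bd K le = u - link x z *m cone_mx K x.
  by rewrite (bd_cone lePO Hu) bu.
have cz' : cycle_on le (S :\ x) k.+1 z'.
  split; last first.
    rewrite /z' mulmxDl mulmxBl cz.2 sub0r (bd_cone lePO cl.1) cl.2 mul0mx subr0.
    by rewrite bu addNr.
  apply: chain_onD; last exact: chain_onW Hu.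
  move=> s; rewrite coef_subv coef_cone coef_link setD11.
  have [xs|xs] := boolP (x \in s); first by rewrite setD1K // subrr eqxx.
  rewrite subr0 => /cz.1[/andP[sS cs] ->]; split=> //.
  rewrite /face cs andbT; apply/subsetP=> y ys; rewrite !inE (subsetP sS) // andbT.
  by apply: contraNneq xs => <-.
have [||||u' [y [Hu' cy yS Ez']]] := IH _ _ _ _ _ _ cz'.
- by move: leN; rewrite (cardsD1 x) xS add1n.
- move=> w y; rewrite !inE => /andP[nwx wS] lyw; rewrite (dS _ _ wS) // andbT.
  apply: contraTneq (h_mono lyw) => ->; rewrite -leqNgt; exact: xmax.
- by move=> w /(subsetP sSx); apply: gS.
- by move=> w /(subsetP sSx); apply: bS.
exists (u' - u *m cone_mx K x), y; split.
- apply: chain_onD; first exact: chain_onW Hu'.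
  rewrite -scaleN1r; apply: chain_onZ; apply: chain_on_cone => //.
  exact: subset_trans sSx.
- by split; [apply: chain_onW cy.1|exact: cy.2].
- apply: submx_trans yS _; apply: row_span_subset; apply/subsetP=> w.
  by rewrite !inE -andbA => /and3P[_ -> ->].
by rewrite mulmxBl bcu addrA -Ez' /z' opprB addrACA subrK subrr addr0.
Qed.

End Graded.

(** * Heights of elements and dimensions of order complexes *)

Section Height.
Variables (B : finType) (le : rel B) (lePO : is_porder le).
Implicit Types (s S : {set B}).

Definition height (x : B) : nat :=
  (\max_(c : {set B} | face le (atmost le x) c) #|c|)%N.

Lemma face_atmostU1 x s : face le (below le x) s -> face le (atmost le x) (x |: s).
Proof.
have [rle _ _] := lePO => /andP[sx cs]; rewrite /face is_chainU1 // andbT.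
apply/subsetP=> y; rewrite !inE => /orP[/eqP->|/(subsetP sx)]; first exact: rle.
by rewrite inE => /andP[].
Qed.

Lemma card_face_below x s : face le (below le x) s -> (#|s| < height x)%N.
Proof.
move=> fs; apply: leq_trans (leq_bigmax_cond _ (face_atmostU1 fs)).
rewrite cardsU1; case: (boolP (x \in s)) => //= xs.
by case/andP: fs => /subsetP/(_ _ xs); rewrite (negPf (below_irr _ _)).
Qed.

Lemma face0 S : face le S set0.
Proof. by rewrite /face sub0set; apply/is_chainP=> x y; rewrite inE. Qed.

Lemma height_gt0 x : (0 < height x)%N.
Proof. by apply: leq_ltn_trans (card_face_below (face0 _)). Qed.

Lemma height_mono x y : ltr le x y -> (height x < height y)%N.
Proof.
move=> lxy; rewrite -(prednK (height_gt0 y)) ltnS; apply/bigmax_leqP=> s /andP[sx cs].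
rewrite -ltnS (prednK (height_gt0 y)); apply: card_face_below.
rewrite /face cs andbT; apply/subsetP=> u /(subsetP sx); rewrite !inE.
have [->|nux] := eqVneq u x; first by [].
by move=> lux; apply: strict_trans lxy => //; rewrite /ltr nux.
Qed.

(** On a chain of elements at most [x] the values of [h] are distinct and lie in [1..h x]. This
    later keeps heights from growing when the order is refined. *)
Lemma height_le (h : B -> nat) x : (forall y, (0 < h y)%N) ->
  (forall y w, ltr le y w -> (h y < h w)%N) -> (height x <= h x)%N.
Proof.
move=> h_gt0 h_mono; apply/bigmax_leqP=> s /andP[sx cs].
apply: (card_chain_le h_gt0 h_mono cs) => y /(subsetP sx); rewrite inE => lyx.
by have [->|nyx] := eqVneq y x; rewrite // ltnW // h_mono // /ltr nyx.
Qed.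

Lemma dP_height S x : (forall y, le y x -> y \in S) -> dP le S x = (height x)%:Z - 1.
Proof.
move=> dS; rewrite /dP /cdim; suff -> : S :&: atmost le x = atmost le x by [].
by apply/setIidPr/subsetP=> y; rewrite inE => /dS.
Qed.

Lemma cdim_below x : cdim le (below le x) = (height x).-1%:Z - 1.
Proof.
rewrite /cdim; congr (_%:Z - 1); apply/eqP; rewrite eqn_leq; apply/andP; split.
  by apply/bigmax_leqP=> s fs; rewrite -ltnS (prednK (height_gt0 x)) card_face_below.
rewrite -ltnS (prednK (height_gt0 x)); apply/bigmax_leqP=> s /andP[sx cs].
have fs : face le (below le x) (s :\ x).
  rewrite /face (is_chainS _ cs) ?subsetDl // andbT; apply/subsetP=> y.
  by rewrite !inE => /andP[nyx /(subsetP sx)]; rewrite /ltr nyx inE.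
apply: leq_trans (_ : #|s :\ x|.+1 <= _)%N; first by rewrite (cardsD1 x); case: (_ \in _).
by rewrite ltnS; apply: leq_bigmax_cond fs.
Qed.

End Height.

(** * Chains and boundaries under a refinement of the order *)

Section Refinement.
Variables (K : fieldType) (B : finType) (leP leQ : rel B).
Hypotheses (leQ_porder : is_porder leQ) (leQ_refines : forall x y, leP x y -> leQ x y).
Implicit Types (v : 'rV[K]_(nS B)) (s S T : {set B}).

Lemma is_chain_refine s : is_chain leP s -> is_chain leQ s.
Proof.
move=> /is_chainP cs; apply/is_chainP=> x y xs ys.
by case/orP: (cs x y xs ys) => /leQ_refines ->; rewrite ?orbT.
Qed.

Lemma chain_on_refine S T k v : S \subset T -> chain_on leP S k v -> chain_on leQ T k v.
Proof.
move=> sST Hv s /Hv[/andP[sS cs] ->]; split=> //.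
by rewrite /face is_chain_refine // (subset_trans sS).
Qed.

(** Two vertices of a [leP]-chain are already comparable, so the larger order lists them in the same
    way and every sign is unchanged. *)
Lemma bd_refine S k v : chain_on leP S k v -> v *m bd K leQ = v *m bd K leP.
Proof.
move=> Hv; apply: coef_inj => s; rewrite !coef_bd big_mkcond [RHS]big_mkcond /=.
apply: eq_bigr => w _; case: (boolP (w \in s)) => //= ws.
have [/eqP->|/Hv[/andP[_ cs] _]] := boolP (coef v (w |: s) == 0).
  by rewrite !mul0r; do 2 case: ifP.
rewrite cs is_chain_refine //; congr (_ * _ ^+ #|pred_of_set _|).
apply/setP=> u; rewrite !inE; case: (boolP (_ || _)) => //= us.
rewrite /ltr; case: (boolP (w != u)) => //= nwu.
apply/idP/idP=> [lwu|/leQ_refines //].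
move/is_chainP: cs => /(_ w u); rewrite !inE eqxx us => /(_ isT isT)/orP[] // /leQ_refines luw.
by case/eqP: nwu; case: leQ_porder => _ aQ _; apply: aQ; rewrite lwu luw.
Qed.

End Refinement.

Lemma rank1_nz_row (F : fieldType) (n p : nat) (M : 'M[F]_(n, p)) :
  \rank M = 1%N -> (nz_row M :=: M)%MS.
Proof.
move=> rM; apply/eqmxP; rewrite -(mxrank_leqif_eq (nz_row_sub M)) rM rank_rV.
by rewrite nz_row_eq0 -mxrank_eq0 rM.
Qed.

(** * Top cycles, cells and the conic complex of [P] *)

Section Main.
Variables (K : fieldType) (B : finType) (m : nat) (deg : B -> 'I_m -> int).
Variable leP : rel B.
Hypotheses (leP_porder : is_porder leP)
  (degP : forall a b : B, leP a b -> leZm (deg a) (deg b))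
  (top1 : forall a : B, hdim K leP (below leP a) (dP leP setT a - 1) = 1%N)
  (exactP : forall alpha : 'I_m -> int, deg_le_set deg alpha != set0 ->
     conic_exact K leP (deg_le_set deg alpha)).

Local Notation h := (height leP).
Let h_gt0 := height_gt0 leP_porder.
Let h_mono := height_mono leP_porder.

Lemma leZm_trans (x y z : 'I_m -> int) : leZm x y -> leZm y z -> leZm x z.
Proof.
by move=> /forallP xy /forallP yz; apply/forallP=> i; apply: le_trans (xy i) (yz i).
Qed.

Lemma leZm_refl (x : 'I_m -> int) : leZm x x.
Proof. by apply/forallP=> i. Qed.

(** Any nonzero row serves as generator, the cycle space being a line. The degree is [d(a) - 1],
    that is, faces with [(h a).-1] vertices. *)
Definition top_cycle a := nz_row (cycles_mx K leP (below leP a) ((h a).-1%:Z - 1)).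
Local Notation g := top_cycle.
Definition cell a := g a *m cone_mx K a.
Local Notation e := cell.

Lemma faces_mx_eq0 (le : rel B) S n :
  (forall s, face le S s -> #|s|%:Z = n + 1 -> False) -> faces_mx K le S n = 0.
Proof.
move=> H; apply/row_matrixP=> i; rewrite row0; apply: coef_inj => s; rewrite coef_zerov.
apply/eqP/negPn/negP; have /faces_mxP Hi := row_sub i (faces_mx K le S n).
by move=> /Hi[]; apply: H.
Qed.

(** No chain below [a] has [h a] vertices, so there are no boundaries in this degree and the
    homology is the cycle space itself. *)
Lemma rank_top_cycles a :
  \rank (cycles_mx K leP (below leP a) ((h a).-1%:Z - 1)) = 1%N.
Proof.
have := top1 a; rewrite dP_height; last by move=> *; rewrite inE.
have -> : (h a)%:Z - 1 - 1 = (h a).-1%:Z - 1 by have := h_gt0 a; lia.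
rewrite /hdim [faces_mx K leP _ (_ + 1)]faces_mx_eq0 ?mul0mx ?mxrank0 ?subn0 //.
move=> s /(card_face_below leP_porder); have := h_gt0 a; lia.
Qed.

Lemma top_cycleE a : (g a :=: cycles_mx K leP (below leP a) ((h a).-1%:Z - 1))%MS.
Proof. exact/rank1_nz_row/rank_top_cycles. Qed.

Lemma top_cycleP a v :
  (v <= g a)%MS <-> cycle_on leP (below leP a) (h a).-1 v.
Proof. by rewrite top_cycleE; split=> /cycles_mxP. Qed.

Lemma top_cycle_cycle a : cycle_on leP (below leP a) (h a).-1 (g a).
Proof. exact/top_cycleP. Qed.

Lemma bd_cell a : e a *m bd K leP = g a.
Proof.
have [Hg bg] := top_cycle_cycle a.
by rewrite /cell (bd_cone leP_porder Hg) bg mul0mx subr0.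
Qed.

Lemma chain_on_cell a (S : {set B}) : a \in S -> below leP a \subset S ->
  chain_on leP S (h a) (e a).
Proof.
move=> aS bS; rewrite -(prednK (h_gt0 a)); apply: chain_on_cone => //.
exact: (top_cycle_cycle a).1.
Qed.

(** In a down-set the dimension at [c] and the elements below [c] are those of the whole poset, so
    each summand is the line spanned by [e c]. *)
Lemma conic_row_span (S : {set B}) k : (forall x y, x \in S -> leP y x -> y \in S) ->
  (conic K leP S k%:Z :=: row_span [set x in S | h x == k.+1] e)%MS.
Proof.
move=> dS; rewrite /conic /=.
have -> : (\sum_(c in S | dP leP S c == k)
    (cycles_mx K leP (S :&: below leP c) (k%:Z - 1) *m cone_mx K c) =
  \sum_(c in [set x in S | h x == k.+1])
    (cycles_mx K leP (S :&: below leP c) (k%:Z - 1) *m cone_mx K c))%MS.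
  apply: eq_bigl => c; rewrite inE; case: (boolP (c \in S)) => //= cS.
  by rewrite dP_height => [|y /(dS _ _ cS)] //; lia.
apply: eqmx_sums => c; rewrite inE => /andP[cS /eqP hc].
apply: eqmx_trans (eqmx_sym (genmxE _)); apply: eqmxMr.
have -> : S :&: below leP c = below leP c.
  by apply/setIidPr/subsetP=> y; rewrite inE => /andP[_ /(dS _ _ cS)].
by have := top_cycleE c; rewrite hc => /eqmx_sym.
Qed.

(** Exactness enters here, at [alpha = deg a], where the lower set contains [a]. The filling is a
    combination of cells of degree [k], whose apexes [y] have height [k.+1] and whose boundaries are
    the [g y]. *)
Lemma conic_cycle_bounds a k (v : 'rV[K]_(nS B)) :
  let D := deg_le_set deg (deg a) in
  (v <= conic K leP D (k%:Z - 1))%MS -> v *m bd K leP = 0 ->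
  (v <= row_span [set y in D | h y == k.+1] g)%MS.
Proof.
move=> D vC bv.
have dD x y : x \in D -> leP y x -> y \in D.
  by rewrite !inE => lx /degP /leZm_trans; apply.
have D0 : D != set0 by apply/set0Pn; exists a; rewrite inE leZm_refl.
have /andP[+ _] := exactP D0 (k%:Z - 1); rewrite subrK => sC.
have /submxP[w Ev] : (v <= conic K leP D k *m bd K leP)%MS.
  by apply: submx_trans sC; rewrite sub_capmx vC; apply/sub_kermxP.
have /row_spanP[mu Emu] : (w *m conic K leP D k <= row_span [set y in D | h y == k.+1] e)%MS.
  by rewrite -(conic_row_span k dD) submxMl.
apply/row_spanP; exists mu; rewrite Ev mulmxA Emu mulmx_suml.
by apply: eq_bigr => y _; rewrite -scalemxAl bd_cell.
Qed.


(** * The order [Q] and the homology of its lower intervals *)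

Section RefinedOrder.
Variable X : B -> {set B}.
Hypothesis X_P : forall c,
  [set x in below leP c | (h x).+1 == h c] \subset X c.
Hypothesis X_deg : forall c,
  X c \subset [set x in deg_le_set deg (deg c) | (h x).+1 == h c].
Hypothesis X_span : forall c,
  (row_span [set x in deg_le_set deg (deg c) | (h x).+1 == h c] g
     <= row_span (X c) g)%MS.
Hypothesis X_free : forall c mu, \sum_(x in X c) mu x *: g x = 0 ->
  forall x, x \in X c -> x \notin [set x in below leP c | (h x).+1 == h c] ->
  mu x = 0.

Definition leQ (x c : B) : bool :=
  (x == c) || [&& (h x < h c)%N, leZm (deg x) (deg c)
                & ((h x).+1 == h c) ==> (x \in X c)].

Lemma ltQE x c : ltr leQ x c =
  [&& (h x < h c)%N, leZm (deg x) (deg c) & ((h x).+1 == h c) ==> (x \in X c)].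
Proof.
by rewrite /ltr /leQ; case: eqP => //= ->; rewrite ltnn.
Qed.

Lemma ltQ_height x c : ltr leQ x c -> (h x < h c)%N.
Proof. by rewrite ltQE => /andP[]. Qed.

Lemma leQ_porder : is_porder leQ.
Proof.
split=> [x|x y|y x z]; first by rewrite /leQ eqxx.
  move=> /andP[/orP[/eqP-> //|/andP[lxy _]]] /orP[/eqP-> //|/andP[lyx _]].
  by move: (ltn_trans lxy lyx); rewrite ltnn.
move=> lxy lyz; case/orP: (lyz) => [/eqP<- //|/and3P[hyz dyz _]].
case/orP: (lxy) => [/eqP-> //|/and3P[hxy dxy _]].
rewrite /leQ (ltn_trans hxy hyz) (leZm_trans dxy dyz) /=; apply/orP; right.
(* Two strict steps raise the height by at least two, so the premise of the condition on [X z]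
   fails. *)
by apply/implyP=> /eqP; lia.
Qed.

Lemma leQ_refines x y : leP x y -> leQ x y.
Proof.
move=> lxy; rewrite /leQ; have [//|nxy] /= := eqVneq x y.
have sxy : ltr leP x y by rewrite /ltr nxy.
rewrite h_mono // degP //=; apply/implyP=> Eh.
by apply: (subsetP (X_P y)); rewrite !inE sxy.
Qed.

Lemma leQ_deg x y : leQ x y -> leZm (deg x) (deg y).
Proof. by case/orP=> [/eqP->|/and3P[]] //; apply: leZm_refl. Qed.

Lemma below_leQ a : below leP a \subset below leQ a.
Proof.
by apply/subsetP=> x; rewrite !inE /ltr => /andP[-> /leQ_refines].
Qed.

(** Chains of [P] are chains of [Q], which gives one inequality; for the other, [h] itself increases
    strictly along [leQ]. *)
Lemma heightQ x : height leQ x = h x.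
Proof.
apply/eqP; rewrite eqn_leq (height_le _ h_gt0 ltQ_height) /=.
apply/bigmax_leqP=> s /andP[sx cs].
have fs : face leQ (atmost leQ x) s.
  rewrite /face (is_chain_refine leQ_refines cs) andbT; apply: subset_trans sx _.
  by apply/subsetP=> y; rewrite !inE => /leQ_refines.
exact: leq_bigmax_cond fs.
Qed.

Lemma bdQ_cell x : e x *m bd K leQ = g x.
Proof.
by rewrite (bd_refine leQ_porder leQ_refines (@chain_on_cell x setT _ _)) ?bd_cell ?inE ?subsetT.
Qed.

Lemma chain_onQ_cells (S Y : {set B}) k mu :
  (forall x y, x \in S -> ltr leQ y x -> y \in S) ->
  Y \subset [set x in S | h x == k] ->
  chain_on leQ S k (\sum_(x in Y) mu x *: e x).
Proof.
move=> dS sY; apply: chain_on_sum => x /(subsetP sY); rewrite inE => /andP[xS /eqP<-].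
apply: chain_onZ; apply: (chain_on_refine leQ_refines (subxx S)).
apply: chain_on_cell => //; apply/subsetP=> y /(subsetP (below_leQ x)).
by rewrite inE => /(dS _ _ xS).
Qed.

Lemma bdQ_cells (Y : {set B}) mu :
  (\sum_(x in Y) mu x *: e x) *m bd K leQ = \sum_(x in Y) mu x *: g x.
Proof.
by rewrite mulmx_suml; apply: eq_bigr => x _; rewrite -scalemxAl bdQ_cell.
Qed.

Lemma bdP_cells (Y : {set B}) mu :
  (\sum_(x in Y) mu x *: e x) *m bd K leP = \sum_(x in Y) mu x *: g x.
Proof.
by rewrite mulmx_suml; apply: eq_bigr => x _; rewrite -scalemxAl bd_cell.
Qed.

Lemma belowQ_trans c x y : x \in below leQ c -> ltr leQ y x -> y \in below leQ c.
Proof. by rewrite !inE => lxc lyx; apply: strict_trans lxc => //; apply: leQ_porder. Qed.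

Lemma belowQ_top c :
  [set x in below leQ c | (h x).+1 == h c] = X c.
Proof.
apply/setP=> x; rewrite !inE ltQE; apply/idP/idP => [/andP[/and3P[_ _ /implyP xX]]//|xX].
have := subsetP (X_deg c) _ xX; rewrite !inE => /andP[-> /eqP<-].
by rewrite ltnSn eqxx xX.
Qed.

Lemma chain_on_card0 (S T : {set B}) (v : 'rV[K]_(nS B)) (le le' : rel B) :
  chain_on le S 0 v -> chain_on le' T 0 v.
Proof. by move=> Hv s /Hv[_ s0]; rewrite (cards0_eq s0) cards0; split=> //; apply: face0. Qed.

(** Strong induction on [h c]; [j] counts vertices. For elements below [c] the two halves are
    exactly the conditions on links under which a cycle of [Q_{<c}] can be reduced to a conic
    one. *)
Lemma hcw_step c :
  (forall v, cycle_on leQ (below leQ c) (h c).-1 v -> (v <= g c)%MS) /\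
  (forall j v, j != (h c).-1 -> cycle_on leQ (below leQ c) j v ->
     exists2 u, chain_on leQ (below leQ c) j.+1 u & u *m bd K leQ = v).
Proof.
have [N] := ubnP (h c); elim: N c => // N IH c; rewrite ltnS => leN.
have gS k x : x \in below leQ c -> h x = k.+1 ->
    forall v, cycle_on leQ (below leQ x) k v -> (v <= g x)%MS.
  rewrite inE => /ltQ_height lxc hx v cv; apply: (IH x _).1; last by rewrite hx.
  exact: leq_trans lxc leN.
have bS k x : x \in below leQ c -> h x != k.+1 ->
    forall v, cycle_on leQ (below leQ x) k v ->
    exists2 u, chain_on leQ (below leQ x) k.+1 u & u *m bd K leQ = v.
  rewrite inE => /ltQ_height lxc hx v; apply: (IH x _).2.
    exact: leq_trans lxc leN.
  by apply: contraNneq hx => ->; rewrite prednK.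
split=> [v|j v njc cv].
  case Eh: (h c) => [|[|k]] /= cv; first by have := h_gt0 c; rewrite Eh.
    (* Height one: [v] is supported on the empty face, which both order complexes share. *)
    have Hv : chain_on leP (below leP c) 0 v by apply: chain_on_card0 cv.1.
    by apply/top_cycleP; rewrite Eh; split=> //; rewrite -(bd_refine leQ_porder leQ_refines Hv) cv.2.
  have EX : [set x in below leQ c | h x == k.+1] = X c.
    by rewrite -belowQ_top Eh; apply/setP=> x; rewrite !inE.
  have /row_spanP[mu] : (v <= row_span [set x in below leQ c | h x == k.+1] e)%MS.
    apply: (top_cycle_conic leQ_porder h_gt0 ltQ_height _ (gS k) cv) => x.
    by rewrite inE => /ltQ_height; rewrite Eh.
  (* Now [v] is a combination of cells with apex in [X c], and its vanishing boundary is a relation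
     among the [g x]. By [X_free] the coefficients vanish off [P_{<c}], so [v] is a cycle of
     [P_{<c}]. *)
  rewrite EX => Ev; have := cv.2; rewrite Ev bdQ_cells => mu0.
  pose X0 := [set x in below leP c | (h x).+1 == h c].
  have Ev0 (f : B -> 'rV[K]_(nS B)) :
      \sum_(x in X c) mu x *: f x = \sum_(x in X0) mu x *: f x.
    rewrite (big_setID X0) /= (setIidPr (X_P c)) [X in _ + X]big1 ?addr0 //.
    by move=> x /setDP[xX /(X_free mu0 xX)->]; rewrite scale0r.
  rewrite Ev0; apply/top_cycleP; split; last by rewrite bdP_cells -Ev0.
  apply: chain_on_sum => x; rewrite inE => /andP[xc /eqP hx].
  apply: chain_onZ; rewrite -hx; apply: chain_on_cell => //.
  apply/subsetP=> y; move: xc; rewrite !inE => lxc lyx.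
  exact: (strict_trans leP_porder lyx lxc).
have [lcj|ljc] := leqP (h c).-1 j.
  (* Chains of [Q_{<c}] have at most [(h c).-1] vertices, so [v] is zero. *)
  exists 0; first exact: chain_on0.
  rewrite mul0mx; apply: coef_inj => s; rewrite coef_zerov; apply/esym/eqP/negPn/negP.
  move=> /cv.1[/(card_face_below leQ_porder)]; rewrite heightQ => lt Es.
  by move: lcj njc lt (h_gt0 c); rewrite Es; lia.
(* Modulo a boundary of [Q_{<c}], [v] becomes a conic cycle [y] of [P] in degrees at most [deg c].
   For [j = 0] it already lies in the augmentation term. *)
have [u [y [Hu cy yC ->]]] : exists u y, [/\ chain_on leQ (below leQ c) j.+1 u,
    y *m bd K leP = 0, (y <= conic K leP (deg_le_set deg (deg c)) (j%:Z - 1))%MS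
    & v = y + u *m bd K leQ].
  case: j cv {njc ljc} => [|k] cv.
    exists 0, v; split; [exact: chain_on0| | |by rewrite mul0mx addr0].
      have Hv : chain_on leP setT 0 v by apply: chain_on_card0 cv.1.
      by rewrite -(bd_refine leQ_porder leQ_refines Hv) cv.2.
    rewrite /conic sub0r eqxx; apply/faces_mxP=> s /cv.1[_ s0].
    by rewrite (cards0_eq s0) cards0 face0.
  have [u [y [Hu cy yC Ev]]] :=
    push_down leQ_porder h_gt0 ltQ_height (@belowQ_trans c) (gS k) (bS k) cv.
  exists u, y; split=> //.
    by have /row_spanP[mu Ey] := yC; rewrite Ey bdP_cells -bdQ_cells -Ey cy.2.
  have -> : k.+1%:Z - 1 = k by lia.
  rewrite conic_row_span; last by move=> a b; rewrite !inE => da /degP/leZm_trans; apply.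
  apply: submx_trans yC _; apply: row_span_subset; apply/subsetP=> x.
  by rewrite !inE ltQE => /andP[/and3P[_ -> _] ->].
have := conic_cycle_bounds yC cy.
(* One height below [c] this is [X_span]. At lower heights every element of degree at most [deg c]
   lies in [Q_{<c}] by definition of [leQ]. *)
have sub : (row_span [set y in deg_le_set deg (deg c) | h y == j.+1] g
     <= row_span [set y in below leQ c | h y == j.+1] g)%MS.
  have [Ej|nj] := eqVneq j.+2 (h c).
    have E (S : {set B}) : [set y in S | h y == j.+1] = [set y in S | (h y).+1 == h c].
      by rewrite -Ej; apply/setP=> w; rewrite !inE.
    by rewrite !E belowQ_top.
  apply: row_span_subset; apply/subsetP=> x; rewrite !inE ltQE => /andP[-> /eqP hx].
  rewrite hx eqxx (negPf nj) !andbT /=; lia.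
move=> /submx_trans/(_ sub)/row_spanP[mu Ey].
exists (\sum_(x in [set y in below leQ c | h y == j.+1]) mu x *: e x + u).
  apply: chain_onD => //; apply: chain_onQ_cells => // a b.
  exact: belowQ_trans.
by rewrite mulmxDl bdQ_cells -Ey.
Qed.

(** Both spaces are the line spanned by [g c]: one inclusion is the top-degree half of [hcw_step],
    the other holds because a cycle of [P_{<c}] remains one in [Q_{<c}]. *)
Lemma cyclesQ c :
  (cycles_mx K leQ (below leQ c) ((h c).-1%:Z - 1) :=:
   cycles_mx K leP (below leP c) ((h c).-1%:Z - 1))%MS.
Proof.
apply: eqmx_trans (top_cycleE c); apply/eqmxP/andP; split.
  by apply/rV_subP=> v /cycles_mxP; apply: (hcw_step c).1.
have [Hg bg] := top_cycle_cycle c.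
apply/cycles_mxP; split; last by rewrite (bd_refine leQ_porder leQ_refines Hg).
exact: (chain_on_refine leQ_refines (below_leQ c) Hg).
Qed.

Lemma dPQ a : dP leP setT a = dP leQ setT a.
Proof. by rewrite !dP_height ?heightQ // => x _; rewrite inE. Qed.

Lemma hcwQ : hcw_poset K leQ.
Proof.
split=> [|a n]; first exact: leQ_porder.
rewrite (cdim_below leQ_porder) heightQ /hdim -/(cycles_mx K leQ (below leQ a) n).
have [->|nn] := eqVneq n.
  rewrite cyclesQ rank_top_cycles faces_mx_eq0 ?mul0mx ?mxrank0 //.
  move=> s /(card_face_below leQ_porder); rewrite heightQ; have := h_gt0 a; lia.
apply/eqP; rewrite subn_eq0; apply: mxrankS.
(* Below degree [-1] there are no faces; otherwise [n + 1] is a number of vertices. *)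
have [n1|n1] := boolP (-1 <= n); last first.
  rewrite /cycles_mx faces_mx_eq0 ?cap0mx ?sub0mx // => s _; lia.
have [j En] : exists j : nat, n = j%:Z - 1 by exists (absz (n + 1)); lia.
rewrite {}En in nn *; apply/rV_subP=> v /cycles_mxP cv.
have [|u Hu <-] := (hcw_step a).2 _ _ _ cv; first by apply: contraNneq nn => ->.
apply: submxMr; apply/faces_mxP=> s /Hu[-> ->]; split=> //; lia.
Qed.

(** Dimensions agree in the two orders, so the sums run over the same elements, and the summands
    agree because the top cycles do. Degree [-1] is spanned by the empty face in both. *)
Lemma conicQ n : (conic K leP setT n == conic K leQ setT n)%MS.
Proof.
apply/eqmxP; rewrite /conic; have [_|n1] := eqVneq n.
  suff -> : faces_mx K leP setT (-1) = faces_mx K leQ setT (-1) by [].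
  rewrite /faces_mx; congr diag_mx; apply/rowP=> j; rewrite !mxE; congr (_%:R).
  case: (boolP (#|enum_val j|%:Z == -1 + 1)); rewrite ?andbF //= addNr => /eqP[s0].
  by rewrite (cards0_eq s0) !face0.
under [X in (_ :=: X)%MS]eq_bigl => c do rewrite -dPQ.
apply: eqmx_sums => c /andP[_ /eqP <-]; rewrite !setTI dP_height; last by move=> *; rewrite inE.
apply: eqmxMr; have -> : (h c)%:Z - 1 - 1 = (h c).-1%:Z - 1 by have := h_gt0 c; lia.
exact/eqmx_sym/cyclesQ.
Qed.

End RefinedOrder.
End Main.

(** * Choice of the sets [X c] and conclusion *)

Theorem mainTheorem11 (K : fieldType) (B : finType) (m : nat)
  (deg : B -> 'I_m -> int) (leP : rel B) :
  is_porder leP ->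
  (forall a b : B, leP a b -> leZm (deg a) (deg b)) ->
  (forall a : B, hdim K leP (below leP a) (dP leP setT a - 1) = 1%N) ->
  (forall alpha : 'I_m -> int, deg_le_set deg alpha != set0 ->
     conic_exact K leP (deg_le_set deg alpha)) ->
  exists leQ : rel B,
    [/\ hcw_poset K leQ,
        forall a b : B, leP a b -> leQ a b,
        forall a b : B, leQ a b -> leZm (deg a) (deg b),
        forall a : B, dP leP setT a = dP leQ setT a
      & forall n : int, (conic K leP setT n == conic K leQ setT n)%MS].
Proof.
move=> leP_porder degP top1 exactP.
pose h := height leP.
have /fin_all_exists[X HX] : forall c, exists X : {set B},
    [/\ [set x in below leP c | (h x).+1 == h c] \subset X,
        X \subset [set x in deg_le_set deg (deg c) | (h x).+1 == h c],
        (row_span [set x in deg_le_set deg (deg c) | (h x).+1 == h c] (top_cycle K leP)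
           <= row_span X (top_cycle K leP))%MS
      & forall mu, \sum_(x in X) mu x *: top_cycle K leP x = 0 ->
        forall x, x \in X -> x \notin [set x in below leP c | (h x).+1 == h c] ->
        mu x = 0].
  (* The starting set lies in the candidate set because [deg] is monotone on [P]. *)
  move=> c; apply: row_span_extension; apply/subsetP=> x; rewrite !inE.
  by case/andP=> /andP[_ /degP ->].
have X_P c : [set x in below leP c | (h x).+1 == h c] \subset X c by case: (HX c).
have X_deg c : X c \subset [set x in deg_le_set deg (deg c) | (h x).+1 == h c].
  by case: (HX c).
have X_span c :
    (row_span [set x in deg_le_set deg (deg c) | (h x).+1 == h c] (top_cycle K leP)
       <= row_span (X c) (top_cycle K leP))%MS by case: (HX c).
have X_free c mu : \sum_(x in X c) mu x *: top_cycle K leP x = 0 ->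
    forall x, x \in X c -> x \notin [set x in below leP c | (h x).+1 == h c] ->
    mu x = 0 by case: (HX c) => _ _ _; apply.
exists (leQ deg leP X); split.
- exact: hcwQ.
- exact: leQ_refines.
- exact: leQ_deg.
- exact: dPQ.
- exact: conicQ.
Qed.
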